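(* There exists a compactly supported Borel probability measure $\mu$ in $\mathbb{R}^2$ with positive Hausdorff dimension (and hence with non-singleton support), such that for every line $V \subset \mathbb{R}^2$ through the origin (one-dimensional linear subspace), the orthogonal projection $P_V\colon \mathbb{R}^2 \to V$ is injective on a Borel set $X_V$ of full $\mu$-measure.
   Context: The (upper) Hausdorff dimension of a finite Borel measure $\mu$ in $\mathbb{R}^N$ is $\dim_H\mu = \inf\{\dim_H X : X\subset\mathbb{R}^N \text{ Borel with } \mu(\mathbb{R}^N\setminus X)=0\}$, where $\dim_H X$ is the Hausdorff dimension of the set $X$. The set $X_V$ may depend on $V$; full $\mu$-measure means $\mu(\mathbb{R}^2\setminus X_V)=0$. *)

(* Defs.v *)
From HB Require Import structures.
From mathcomp Require Import all_boot all_order all_algebra.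
From mathcomp Require Import all_classical all_reals all_analysis.
Set Implicit Arguments.
Unset Strict Implicit.
Unset Printing Implicit Defensive.
Import Order.TTheory GRing.Theory Num.Theory.
Import numFieldNormedType.Exports.
Local Open Scope classical_set_scope.
Local Open Scope ring_scope.

(* 'rV[R]_n with the Borel sigma-algebra; the library norm on 'rV[R]_n is the
   sup norm, which induces the same topology as the Euclidean norm. *)
Definition borelRV (R : realType) (n : nat) :=
  g_sigma_algebraType (@open 'rV[R]_n).

Definition dotv (R : realType) (n : nat) (x y : 'rV[R]_n) : R :=
  \sum_(i < n) x ord0 i * y ord0 i.

Definition edist (R : realType) (n : nat) (x y : 'rV[R]_n) : R :=
  Num.sqrt (dotv (x - y) (x - y)).

(* Equal to -oo on the empty set. *)
Definition diam (R : realType) (n : nat) (E : set 'rV[R]_n) : \bar R :=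
  ereal_sup [set (edist x y)%:E | x in E & y in E].

(* diam(E)^s, with diam(set0)^s = 0 for every s, and diam(E)^0 = 1 for E
   nonempty (also when E is a singleton, as 0 `^ 0 = 1). *)
Definition diam_pow (R : realType) (n : nat) (s : R) (E : set 'rV[R]_n) :
    \bar R :=
  if E == set0 then 0%E else poweR (diam E) s.

Definition hausdorff_premeasure (R : realType) (n : nat) (s delta : R)
    (A : set 'rV[R]_n) : \bar R :=
  ereal_inf [set (\sum_(0 <= k <oo) diam_pow s (F k))%E |
    F in [set F : (set 'rV[R]_n)^nat |
      A `<=` \bigcup_k F k /\ forall k, (diam (F k) <= delta%:E)%E]].

Definition hausdorff_measure (R : realType) (n : nat) (s : R)
    (A : set 'rV[R]_n) : \bar R :=
  ereal_sup [set hausdorff_premeasure s delta A | delta in [set d : R | 0 < d]].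

Definition hausdorff_dim (R : realType) (n : nat) (A : set 'rV[R]_n) :
    \bar R :=
  ereal_inf [set s%:E | s in
    [set s : R | 0 <= s /\ hausdorff_measure s A = 0%E]].

Definition measure_hausdorff_dim (R : realType) (n : nat)
    (mu : set (borelRV R n) -> \bar R) : \bar R :=
  ereal_inf [set hausdorff_dim X | X in
    [set X : set (borelRV R n) | measurable X /\ mu (~` X) = 0%E]].

Definition measure_support (R : realType) (n : nat)
    (mu : set (borelRV R n) -> \bar R) : set 'rV[R]_n :=
  [set x | forall U : set 'rV[R]_n, open U -> U x -> (0 < mu U)%E].

Definition is_orthproj (R : realType) (n : nat) (V : {vspace 'rV[R]_n})
    (x y : 'rV[R]_n) : Prop :=
  y \in V /\ forall v, v \in V -> dotv (x - y) v = 0.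

(* The default value 0 is never used, by orthprojP below. *)
Definition orthproj (R : realType) (n : nat) (V : {vspace 'rV[R]_n})
    (x : 'rV[R]_n) : 'rV[R]_n :=
  xget 0 [set y | is_orthproj V x y].

Lemma dotvDl (R : realType) (n : nat) (a : R) (x y z : 'rV[R]_n) :
  dotv (a *: x + y) z = a * dotv x z + dotv y z.
Proof.
rewrite /dotv mulr_sumr -big_split /=; apply: eq_bigr => i _.
by rewrite !mxE mulrDl mulrA.
Qed.

Lemma dotvC (R : realType) (n : nat) (x y : 'rV[R]_n) : dotv x y = dotv y x.
Proof. by apply: eq_bigr => i _; rewrite mulrC. Qed.

Lemma dotv_eq0 (R : realType) (n : nat) (x : 'rV[R]_n) :
  dotv x x = 0 -> x = 0.
Proof.
move=> /eqP; rewrite psumr_eq0; last by move=> i _; rewrite -expr2 sqr_ge0.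
move=> /allP h; apply/rowP => i; rewrite mxE; apply/eqP.
by have := h i (mem_index_enum i); rewrite -expr2 sqrf_eq0.
Qed.

Lemma orthproj_exists (R : realType) (n : nat) (V : {vspace 'rV[R]_n})
  (x : 'rV[R]_n) : exists y, is_orthproj V x y.
Proof.
pose f (x : 'rV[R]_n) : 'rV[R]_(\dim V) := \row_i dotv x (vbasis V)`_i.
have flin : linear f.
  by move=> a u v; apply/rowP => i; rewrite !mxE dotvDl.
pose fL : {linear 'rV[R]_n -> 'rV[R]_(\dim V)} :=
  HB.pack f (GRing.isLinear.Build _ _ _ _ f flin).
pose K := lker (linfun fL).
have KP u : u \in K -> forall v, v \in V -> dotv u v = 0.
  rewrite memv_ker lfunE /= => /eqP/rowP fu0 v vV.
  rewrite (coord_vbasis vV) dotvC.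
  elim/big_ind : _ => [|a b a0 b0|i _].
  - by rewrite /dotv big1// => i _; rewrite mxE mul0r.
  - by rewrite -[a]scale1r dotvDl a0 b0 mulr0 addr0.
  - rewrite -[X in dotv X _]addr0 dotvDl dotvC.
    have := fu0 i; rewrite !mxE => ->.
    by rewrite mulr0 add0r /dotv big1// => j _; rewrite mxE mul0r.
have VK0 : (V :&: K = 0)%VS.
  apply/eqP; rewrite -subv0; apply/subvP => u; rewrite memv_cap => /andP[uV uK].
  by rewrite memv0; apply/eqP/dotv_eq0; exact: KP.
have VKT : (V + K = fullv)%VS.
  apply/eqP; rewrite eqEdim subvf /= (dimv_disjoint_sum VK0).
  rewrite -(limg_ker_dim (linfun fL) fullv) capfv -/K addnC leq_add2r.
  by rewrite (leq_trans (dimvS (subvf _)))// dimvf /dim /= mul1n.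
have /memv_addP[y yV [z zK xE]] : x \in (V + K)%VS by rewrite VKT memvf.
by exists y; split => // v; apply: KP; rewrite xE addrC addKr.
Qed.

Lemma orthprojP (R : realType) (n : nat) (V : {vspace 'rV[R]_n})
  (x : 'rV[R]_n) : is_orthproj V x (orthproj V x).
Proof. by have [y] := orthproj_exists V x; exact: xgetI. Qed.

Lemma orthproj_unique (R : realType) (n : nat) (V : {vspace 'rV[R]_n})
  (x y : 'rV[R]_n) : is_orthproj V x y -> orthproj V x = y.
Proof.
move=> [yV yP]; have [pV pP] := orthprojP V x.
have dV : orthproj V x - y \in V by exact: memvB.
apply/eqP; rewrite -subr_eq0; apply/eqP/dotv_eq0.
rewrite {1}(_ : _ - y = -1 *: (x - orthproj V x) + (x - y)).
  by rewrite dotvDl pP// yP// mulr0 addr0.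
by rewrite scaleN1r opprB addrA subrK.
Qed.

(* Main.v *)
Require Import Defs.
From HB Require Import structures.
From mathcomp Require Import all_boot all_order all_algebra.
From mathcomp Require Import all_classical all_reals all_analysis.
From mathcomp Require Import measurable_realfun zify ring lra.
Set Implicit Arguments.
Unset Strict Implicit.
Unset Printing Implicit Defensive.
Import Order.TTheory GRing.Theory Num.Theory.
Import numFieldNormedType.Exports.
Local Open Scope classical_set_scope.
Local Open Scope ring_scope.

(* The measure is the lift to the parabola {(t, t ^ 2)} of the uniform measure
   on the Cantor set C of reals whose base-9 digits all lie in {0, 1, 3}. The
   chord through the points of parameters s and t has slope s + t, so a
   projection along a chord of slope c is injective on the part of the lift of
   C with c - t not in C. Since {0, 1, 3} is a Sidon set and sums of two digits
   do not carry in base 9, each digit of s + t determines the unordered pair of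
   digits of s and t: for a given c, every digit of an s in C with c - s in C is
   confined to at most 2 of the 3 possible values, so such s form a set of
   measure at most (2 / 3) ^ n for all n. The mass distribution principle gives
   dimension at least log 3 / log 9 = 1 / 2. *)

(** * Digit spreading from base 3 to base 9 and the Sidon bound *)

Definition sidon_digit (r : nat) : nat := nth 3 [:: 0; 1]%N r.

(* Reads the last n ternary digits of m as base-9 digits, through sidon_digit.
   The leading part m %/ 3 ^ n is kept unchanged, so that spread n is increasing
   on all of nat and not only below 3 ^ n. *)
Fixpoint spread (n m : nat) : nat :=
  if n is k.+1 then (9 * spread k (m %/ 3) + sidon_digit (m %% 3))%N else m.

(** No bound on [r] is assumed: the third digit 3 is also the default value of [nth]. *)
Lemma sidon_digit_le3 r : (sidon_digit r <= 3)%N.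
Proof. by case: r => [|[|r]] //; rewrite /sidon_digit /= nth_nil. Qed.

Lemma ltn_sidon_digit r r' :
  (r < r')%N -> (r' < 3)%N -> (sidon_digit r < sidon_digit r')%N.
Proof. by case: r r' => [|[|[|r]]] [|[|[|r']]]. Qed.

(** A smaller quotient gains 9, more than the last digits, at most 3, can offset; for equal
    quotients the last digits decide. *)
Lemma ltn_spread n m m' : (m < m')%N -> (spread n m < spread n m')%N.
Proof.
elim: n m m' => [//|n IH] m m' mm' /=.
have := sidon_digit_le3 (m %% 3).
have : (m %/ 3 <= m' %/ 3)%N by rewrite leq_div2r// ltnW.
rewrite leq_eqVlt => /predU1P[qq|/IH]; last by lia.
suff : (sidon_digit (m %% 3) < sidon_digit (m' %% 3))%N by rewrite qq; lia.
by apply: ltn_sidon_digit; rewrite ?ltn_mod//; lia.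
Qed.

Lemma leq_spread n m m' : (m <= m')%N -> (spread n m <= spread n m')%N.
Proof. by rewrite leq_eqVlt => /predU1P[->//|/(ltn_spread n)/ltnW]. Qed.

Definition sidon_summands (k : nat) : seq nat :=
  [seq r <- iota 0 3 |
    has (fun r' => sidon_digit r + sidon_digit r' == k)%N (iota 0 3)].

Fixpoint spread_summands (n N : nat) : seq nat :=
  if n is k.+1 then
    [seq (3 * q + r)%N | q <- spread_summands k (N %/ 9),
                         r <- sidon_summands (N %% 9)]
  else [:: 0%N].

(** The Sidon property: the sums 0, 1, 2, 3, 4, 6 come from six different unordered pairs of digits.
    Evaluation settles [k] up to 6, and no larger sum occurs. *)
Lemma size_sidon_summands k : (size (sidon_summands k) <= 2)%N.
Proof. by case: k => [|[|[|[|[|[|[|k]]]]]]]. Qed.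

Lemma size_spread_summands n N : (size (spread_summands n N) <= 2 ^ n)%N.
Proof.
elim: n N => [//|n IH] N /=.
by rewrite size_allpairs expnSr leq_mul// size_sidon_summands.
Qed.

(** Two digits sum to at most 6, so there is no carry and division by 9 splits the sum digitwise.
    Only [m] is bounded; the leading part of [m'] is arbitrary. *)
Lemma mem_spread_summands n m m' : (m < 3 ^ n)%N ->
  m \in spread_summands n (spread n m + spread n m').
Proof.
elim: n m m' => [|n IH] m m' /=; first by case: m.
rewrite expnSr => m3.
set q := (m %/ 3)%N; set q' := (m' %/ 3)%N.
have r3 : (m %% 3 < 3)%N by rewrite ltn_mod.
have r3' : (m' %% 3 < 3)%N by rewrite ltn_mod.
have d9 := sidon_digit_le3 (m %% 3); have d9' := sidon_digit_le3 (m' %% 3).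
apply/allpairsP; exists (q, (m %% 3)%N) => /=; split.
- rewrite (_ : (_ %/ 9)%N = (spread n q + spread n q')%N); last by lia.
  by apply: IH; rewrite ltn_divLR.
- rewrite (_ : (_ %% 9)%N = (sidon_digit (m %% 3) + sidon_digit (m' %% 3))%N);
    last by lia.
  rewrite mem_filter mem_iota leq0n add0n r3 !andbT.
  apply/hasP; exists (m' %% 3)%N => //.
  by rewrite mem_iota.
- by rewrite /q; lia.
Qed.

(** * The Cantor map as a limit of nested intervals *)

Section spread_map.
Context {R : realType}.
Implicit Types (w t c : R) (n m : nat).

Definition triadic n w : nat := Num.truncn (3 ^+ n * w).

Lemma triadicS n w : (triadic n.+1 w %/ 3)%N = triadic n w.
Proof.
rewrite /triadic exprS -mulrA; set x := 3 ^+ n * w.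
(* [Num.truncn] is 0 on negative reals, so both sides vanish. *)
have [x0|x0] := ltP x 0.
  have z (y : R) : y < 0 -> Num.truncn y = 0%N :> nat.
    by move=> y0; rewrite truncn_floor leNgt y0.
  by rewrite !z//; lra.
apply/esym/truncn_def.
have /andP[] : (Num.truncn (3 * x))%:R <= 3 * x < (Num.truncn (3 * x)).+1%:R.
  by apply: truncn_itv; lra.
set T := Num.truncn _ => T1 T2.
have T3 : (3 * (T %/ 3) <= T)%N by lia.
have T4 : (T.+1 <= 3 * (T %/ 3).+1)%N by lia.
move: T3 T4; rewrite -!(ler_nat R) !natrM; lra.
Qed.

Definition spread_approx n w : R := (spread n (triadic n w))%:R / 9 ^+ n.

(** The approximations increase with [n], so the supremum is their limit: for [w] in [[0, 1)], the
    real whose base-9 digits are the spread ternary digits of [w]. *)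
Definition spread_map w : R := sup (range (spread_approx ^~ w)).

(* 3 / 9 + 3 / 9 ^ 2 + ... *)
Definition spread_gap : R := 3 / 8.

(** The intervals of length [spread_gap / 9 ^+ n] starting at the approximations are nested: a digit
    is at most 3, and [3 + spread_gap = 9 * spread_gap]. *)
Lemma spread_approxS n w :
  spread_approx n w <= spread_approx n.+1 w /\
  spread_approx n.+1 w + spread_gap / 9 ^+ n.+1
    <= spread_approx n w + spread_gap / 9 ^+ n.
Proof.
rewrite /spread_approx /= triadicS exprS.
have := sidon_digit_le3 (triadic n.+1 w %% 3).
set d := sidon_digit _; set s := spread n _; rewrite -(ler_nat R) => d3.
have d0 : 0 <= d%:R :> R by [].
rewrite natrD natrM.
have : 0 < 9 ^- n :> R by rewrite invr_gt0 exprn_gt0.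
rewrite invfM; set y := 9 ^- n => y0.
rewrite /spread_gap.
split; nra.
Qed.

Lemma spread_approx_le k n w :
  spread_approx k w <= spread_approx n w + spread_gap / 9 ^+ n.
Proof.
pose u j := spread_approx j w.
pose v j := - (spread_approx j w + spread_gap / 9 ^+ j).
have gap0 j : 0 <= spread_gap / 9 ^+ j :> R.
  by rewrite divr_ge0 ?exprn_ge0// /spread_gap; lra.
have u_nd : {homo u : i j / (i <= j)%N >-> i <= j}.
  by apply/nondecreasing_seqP => j; have [] := spread_approxS j w.
have v_nd : {homo v : i j / (i <= j)%N >-> i <= j}.
  apply/nondecreasing_seqP => j; rewrite lerN2.
  by have [] := spread_approxS j w.
case: (leqP k n) => kn.
  by apply: (le_trans (u_nd _ _ kn)); rewrite lerDl.
by move: (v_nd _ _ (ltnW kn)); rewrite /v lerN2; apply: le_trans; rewrite lerDl.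
Qed.

Lemma spread_map_itv n w :
  (spread n (triadic n w))%:R <= 9 ^+ n * spread_map w <=
  (spread n (triadic n w))%:R + spread_gap.
Proof.
have h : has_sup (range (spread_approx ^~ w)).
  split; first by exists (spread_approx 0 w); exists 0%N.
  exists (spread_approx 0 w + spread_gap / 9 ^+ 0) => _ [k _ <-].
  exact: spread_approx_le.
have y0 : 0 < 9 ^+ n :> R by rewrite exprn_gt0.
have L : spread_approx n w <= spread_map w.
  by apply: ub_le_sup; [case: h|exists n].
have U : spread_map w <= spread_approx n w + spread_gap / 9 ^+ n.
  by apply: ge_sup; [case: h|move=> _ [k _ <-]; exact: spread_approx_le].
apply/andP; split.
  by rewrite mulrC -ler_pdivrMr.
by rewrite mulrC -ler_pdivlMr// mulrDl.
Qed.

(** Monotonicity gives measurability; it holds on all of [R] because [spread n] increases on all of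
    [nat]. *)
Lemma nondecreasing_spread_map : {homo spread_map : x y / x <= y}.
Proof.
move=> x y xy; apply: ge_sup; first by exists (spread_approx 0 x); exists 0%N.
move=> _ [n _ <-].
have /andP[Ly _] := spread_map_itv n y.
rewrite /spread_approx ler_pdivrMr ?exprn_gt0// mulrC; apply: le_trans Ly.
rewrite ler_nat; apply: leq_spread; apply: le_truncn.
by rewrite ler_wpM2l// exprn_ge0.
Qed.

(** Different prefixes give integers at least 1 apart, and the tails add at most 3 / 8, so the
    scaled images stay at least 5 / 8 apart. *)
Lemma spread_map_sep n x y : 9 ^+ n * `|spread_map x - spread_map y| < 2^-1 ->
  triadic n x = triadic n y.
Proof.
have y0 : 0 < 9 ^+ n :> R by rewrite exprn_gt0.
rewrite -[X in X * _](ger0_norm (ltW y0)) -normrM mulrBr.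
rewrite ltr_norml => /andP[].
have /andP[] := spread_map_itv n x; have /andP[] := spread_map_itv n y.
rewrite /spread_gap; set a := triadic n x; set b := triadic n y.
move=> h1 h2 h3 h4 h5 h6.
by case: (ltngtP a b) => [/(ltn_spread n)|/(ltn_spread n)|//];
  rewrite -(ler_nat R) -natr1 => ?; exfalso; lra.
Qed.

(** The Cantor set through its level-[n] intervals, which makes it visibly Borel. As [m] may exceed
    [3 ^ n], translates by natural numbers are included. *)
Definition spread_set : set R :=
  [set t | forall n, exists m, (spread n m)%:R <= 9 ^+ n * t <=
                               (spread n m)%:R + spread_gap].

Lemma spread_set_map w : spread_set (spread_map w).
Proof. by move=> n; exists (triadic n w); exact: spread_map_itv. Qed.

(** The two tails sum to at most 3 / 4 < 1, so the integer part of [9 ^+ n * c] is exactly the sum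
    of two spread integers. *)
Lemma triadic_summands c w n : 0 <= w < 1 -> spread_set (c - spread_map w) ->
  triadic n w \in spread_summands n (Num.truncn (9 ^+ n * c)).
Proof.
move=> /andP[w0 w1] /(_ n)[m' ]; rewrite mulrBr => /andP[h1 h2].
have /andP[h3 h4] := spread_map_itv n w.
rewrite (_ : Num.truncn (9 ^+ n * c) =
    (spread n (triadic n w) + spread n m')%N).
  apply: mem_spread_summands; rewrite /triadic truncn_lt_nat.
    by rewrite natrX -[ltRHS]mulr1 ltr_pM2l// exprn_gt0.
  by rewrite mulr_ge0// exprn_ge0.
apply: truncn_def; rewrite -[in ltRHS]natr1 natrD.
move: h1 h2 h3 h4; rewrite /spread_gap => h1 h2 h3 h4; apply/andP; split; lra.
Qed.

End spread_map.

(** * The uniform measure on [[0, 1)] and its image under the Cantor map *)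

Section unit_interval_measure.
Context {R : realType}.
Implicit Types (w t c : R) (n m : nat).

Definition unif01 : set (measurableTypeR R) -> \bar R :=
  mrestr lebesgue_measure (measurable_itv `[0%R, 1%R[).

HB.instance Definition _ := Measure.on unif01.

Let unif01_setT : unif01 setT = 1%E.
Proof.
by rewrite /unif01 /mrestr setTI lebesgue_measure_itv /= lte_fin ltr01 oppr0 adde0.
Qed.

HB.instance Definition _ := Measure_isProbability.Build _ _ _ unif01 unif01_setT.

Definition triadic_itv n m : set R := `[m%:R / 3 ^+ n, m.+1%:R / 3 ^+ n[.

Lemma measurable_triadic_itv n m : measurable (triadic_itv n m).
Proof. exact: measurable_itv. Qed.

Lemma triadic_itvP n m w : 0 <= w -> triadic_itv n m w <-> triadic n w = m.
Proof.
move=> w0; rewrite /triadic_itv /triadic /= in_itv /=.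
have y0 : 0 < 3 ^+ n :> R by rewrite exprn_gt0.
rewrite ler_pdivrMr// ltr_pdivlMr// mulrC.
rewrite -truncn_eq; last by rewrite mulr_ge0// ltW.
by split=> [/eqP|->].
Qed.

Lemma lebesgue_triadic_itv n m :
  lebesgue_measure (triadic_itv n m) = (3 ^- n)%:E.
Proof.
have y0 : 0 < 3 ^- n :> R by rewrite invr_gt0 exprn_gt0.
rewrite lebesgue_measure_itv/= lte_fin ltr_pM2r// ltr_nat ltnSn.
by rewrite -EFinD -mulrBl -natr1 addrAC subrr add0r mul1r.
Qed.

Lemma unif01_triadic_itv_le n m : (unif01 (triadic_itv n m) <= (3 ^- n)%:E)%E.
Proof.
rewrite -(lebesgue_triadic_itv n m) /unif01 /mrestr.
by apply: measureIl; [exact: measurable_itv|exact: measurable_itv].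
Qed.

Lemma unif01_triadic_itv n m : (m < 3 ^ n)%N ->
  unif01 (triadic_itv n m) = (3 ^- n)%:E.
Proof.
move=> m3; rewrite -(lebesgue_triadic_itv n m) /unif01 /mrestr setIidl//.
have y0 : 0 < 3 ^+ n :> R by rewrite exprn_gt0.
apply: subset_itv; rewrite bnd_simp.
  by rewrite divr_ge0// ltW.
by rewrite ler_pdivrMr// mul1r -natrX ler_nat.
Qed.

Lemma unif01_outside : unif01 (~` `[0%R, 1%R[) = 0%E.
Proof. by rewrite /unif01 /mrestr setICl measure0. Qed.

(** Union bound over the triadic intervals indexed by [s], each of mass at most [3 ^- n]. *)
Lemma unif01_triadic_cover n (s : seq nat) (A : set R) : measurable A ->
  (forall w, 0 <= w < 1 -> A w -> triadic n w \in s) ->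
  (unif01 A <= ((size s)%:R / 3 ^+ n)%:E)%E.
Proof.
move=> mA As.
pose U := \big[setU/set0]_(m <- s) triadic_itv n m.
have mU : measurable U.
  by apply: bigsetU_measurable => m _; exact: measurable_triadic_itv.
have -> : unif01 A = unif01 (A `&` `[0%R, 1%R[).
  by rewrite /unif01 /mrestr -setIA setIid.
apply: (@le_trans _ _ (unif01 U)).
  apply: le_measure; rewrite ?inE//; first exact: measurableI.
  move=> w [Aw /=]; rewrite in_itv /= => /[dup] w01 /andP[w0 _].
  rewrite /U -bigcup_seq; exists (triadic n w); first exact: As.
  by apply/triadic_itvP.
rewrite {mU}/U; elim: s {As} => [|m s IH].
  by rewrite big_nil measure0 mul0r.
rewrite big_cons /= -natr1 mulrDl addrC mul1r EFinD.
apply: (le_trans (measureU2 _ _ _)).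
- exact: measurable_triadic_itv.
- by apply: bigsetU_measurable => k _; exact: measurable_triadic_itv.
- by apply: leeD => //; exact: unif01_triadic_itv_le.
Qed.

Lemma measurable_spread_map :
  measurable_fun [set: measurableTypeR R] (@spread_map R).
Proof.
apply: nondecreasing_measurable => //; exact: nondecreasing_spread_map.
Qed.

Lemma measurable_spread_set :
  measurable (@spread_set R : set (measurableTypeR R)).
Proof.
rewrite (_ : @spread_set R = \bigcap_n \bigcup_m
    `[(spread n m)%:R / 9 ^+ n, ((spread n m)%:R + spread_gap) / 9 ^+ n]%classic).
  apply: bigcapT_measurable => n; apply: bigcupT_measurable => m.
  exact: measurable_itv.
have y0 n : 0 < 9 ^+ n :> R by rewrite exprn_gt0.
apply/seteqP; split=> t ht n.
  move=> _; have [m tm] := ht n; exists m => //=.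
  by rewrite in_itv/= ler_pdivrMr// ler_pdivlMr// mulrC.
have [m _ /=] := ht n I; rewrite in_itv/= ler_pdivrMr// ler_pdivlMr// mulrC.
by exists m.
Qed.

Lemma measurable_spread_reflect c :
  measurable [set w | spread_set (c - spread_map w)].
Proof.
have mf : measurable_fun [set: measurableTypeR R] (fun w => c - spread_map w).
  by apply: measurable_funB => //; exact: measurable_spread_map.
by rewrite -[X in measurable X]setTI; apply: mf => //; exact: measurable_spread_set.
Qed.

Lemma geometric_bound_eq0 (q : R) (x : \bar R) : 0 <= q -> q < 1 ->
  (0 <= x)%E -> (forall n, (x <= (q ^+ n)%:E)%E) -> x = 0%E.
Proof.
move=> q0 q1; case: x => [x| |] // x0 h; last by have := h 0%N.
apply/eqP; rewrite eq_le x0 andbT lee_fin.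
have qn : (fun n => q ^+ n) @ \oo --> (0 : R).
  by apply: cvg_expr; rewrite ger0_norm.
rewrite -(cvg_lim (@Rhausdorff R) qn); apply: limr_ge.
  by apply/cvg_ex; exists 0.
by apply: nearW => n; rewrite -lee_fin.
Qed.

(** At each level [n], at most [2 ^ n] of the [3 ^ n] triadic intervals of [[0, 1)] meet this
    set. *)
Lemma unif01_spread_reflect c :
  unif01 [set w | spread_set (c - spread_map w)] = 0%E.
Proof.
set B := [set w | _].
have bound n : (unif01 B <= ((2 / 3) ^+ n)%:E)%E.
  apply: (le_trans (@unif01_triadic_cover n
    (spread_summands n (Num.truncn (9 ^+ n * c))) B _ _)).
  - exact: measurable_spread_reflect.
  - by move=> w w01 Bw; exact: triadic_summands.
  - rewrite lee_fin expr_div_n ler_pM2r ?invr_gt0 ?exprn_gt0//.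
    by rewrite -[leRHS]natrX ler_nat size_spread_summands.
apply: (@geometric_bound_eq0 (2 / 3)); [lra|lra|exact: measure_ge0|exact: bound].
Qed.

(** The Frostman bound: shrinking [r] by 9 divides the mass bound by 3, hence the exponent 1 / 2. *)
Lemma unif01_spread_strip (p r : R) : 0 <= r ->
  (unif01 [set w | `|spread_map w - p| <= r]%R <= (6 * r `^ 2^-1)%:E)%E.
Proof.
move=> r0; set A := [set w | _].
have mA : measurable (A : set (measurableTypeR R)).
  have mf : measurable_fun [set: measurableTypeR R]
      (fun w : R => `|spread_map w - p|).
    apply: measurableT_comp => //; apply: measurable_funB => //.
    exact: measurable_spread_map.
  rewrite (_ : A = setT `&` (fun w : R => `|spread_map w - p|) @^-1` `]-oo, r]).
    by apply: mf => //; exact: measurable_itv.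
  by rewrite setTI; apply/seteqP; split=> w /=; rewrite in_itv.
(* Images of two points of [A] are within [2 * r] of each other, close enough for [spread_map_sep]
   to force a common prefix. *)
have small n : 9 ^+ n * (4 * r) < 1 -> (unif01 A <= (3 ^- n)%:E)%E.
  move=> nr.
  have [->|/set0P[w0 Aw0]] := eqVneq A set0.
    by rewrite measure0 lee_fin invr_ge0 exprn_ge0.
  rewrite -[3 ^- n]mul1r.
  apply: (@unif01_triadic_cover n [:: triadic n w0]) => // w _ Aw.
  rewrite inE; apply/eqP/spread_map_sep.
  apply: (@le_lt_trans _ _ (9 ^+ n * (2 * r))); last first.
    rewrite (_ : 2 * r = (4 * r) / 2); last by field.
    by rewrite mulrA ltr_pdivrMr// mulVf.
  rewrite ler_wpM2l ?exprn_ge0//.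
  rewrite mulr_natl mulr2n (le_trans (ler_distD p _ _))// lerD//.
  by rewrite distrC.
(* For [r = 0] every level is admissible, so the mass is 0. *)
have [r00|rpos] := eqVneq r 0.
  rewrite r00 powR0 ?invr_eq0// mulr0.
  rewrite (_ : unif01 A = 0%E)//.
  apply: (@geometric_bound_eq0 3^-1); [lra|lra|exact: measure_ge0|].
  by move=> n; rewrite exprVn; apply: small; rewrite r00 !mulr0.
have {}rpos : 0 < r by rewrite lt_neqAle eq_sym rpos.
have ex : exists k, 1 <= 9 ^+ k * (4 * r).
  have r4 : 0 < 4 * r by lra.
  exists (Num.truncn (4 * r)^-1).+1.
  rewrite -ler_pdivrMr// mul1r.
  apply: (le_trans (ltW (truncnS_gt _))).
  by rewrite -natrX ler_nat ltnW// ltn_expl.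
(* If the first inadmissible level is 0, then [r >= 1 / 4] and the total mass 1 is a good enough
   bound. If it is [n.+1], level [n] is admissible, and [1 <= 9 ^+ n.+1 * (4 * r)] says that
   [3 ^- n] is at most 6 times the square root of [r]. *)
case: (ex_minnP ex) => -[|n] hn nmin.
  apply: (le_trans (probability_le1 _ mA)).
  rewrite lee_fin powR12_sqrt//.
  have : Num.sqrt (6^-1 ^+ 2) <= Num.sqrt r by apply: ler_wsqrtr; lra.
  by rewrite sqrtr_sqr ger0_norm; lra.
have nr : 9 ^+ n * (4 * r) < 1.
  by rewrite ltNge; apply/negP => /nmin; rewrite ltnn.
apply: (le_trans (small _ nr)).
have t0 : 0 < 3 ^- n :> R by rewrite invr_gt0 exprn_gt0.
rewrite lee_fin powR12_sqrt//.
have : Num.sqrt ((3 ^- n / 6) ^+ 2) <= Num.sqrt r.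
  apply: ler_wsqrtr.
  rewrite exprMn exprVn -exprM mulnC exprM (_ : 3 ^+ 2 = 9); last by ring.
  rewrite mulrC ler_pdivrMr ?exprn_gt0// mulrC.
  by move: hn; rewrite exprS; lra.
by rewrite sqrtr_sqr ger0_norm; lra.
Qed.

End unit_interval_measure.

(** * Continuity, Borel sets and supports in spaces of row vectors *)

Section borel_matrix.
Context {R : realType}.

Lemma continuous_mx (T : topologicalType) m n (f : T -> 'M[R]_(m, n)) :
  (forall i j, continuous (fun x => f x i j)) -> continuous f.
Proof.
move=> fc x A [P Px PA].
apply: (@filterS _ _ _ [set y | forall i j, P i j (f y i j)]).
  by move=> y Py; exact: PA.
apply: filter_forall => i; apply: filter_forall => j.
exact: (fc i j x).
Qed.

Lemma open_borelRV n (U : set 'rV[R]_n) :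
  open U -> measurable (U : set (borelRV R n)).
Proof. exact: sub_sigma_algebra. Qed.

Lemma continuous_measurable_borelRV n (f : 'rV[R]_n -> R) : continuous f ->
  measurable_fun [set: borelRV R n] (f : borelRV R n -> measurableTypeR R).
Proof.
move=> /continuousP cf; apply: (measurability _ (RGenOpens.measurableE R)).
move=> _ [_ [a [b ->]] <-]; rewrite setTI.
by apply: open_borelRV; apply: cf; exact: interval_open.
Qed.

Lemma ler_edist_coord n (x y : 'rV[R]_n) i :
  `|x ord0 i - y ord0 i| <= Defs.edist x y.
Proof.
rewrite /Defs.edist /dotv (bigD1 i)//= !mxE -expr2 -sqrtr_sqr ler_wsqrtr// lerDl.
by apply: sumr_ge0 => j _; rewrite !mxE -expr2 sqr_ge0.
Qed.

Lemma closed_measure_support n (mu : set (borelRV R n) -> \bar R) :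
  closed (measure_support mu).
Proof.
move=> x clx U Uo Ux.
have [y [suppy Uy]] := clx _ (open_nbhs_nbhs (conj Uo Ux)).
exact: suppy.
Qed.

End borel_matrix.

(** * The mass distribution principle *)

Section mass_distribution.
Context {R : realType}.

(** A nonempty [F] lies in the closed ball of radius [d = diam F] about any of its points, and
    [d <= 1] gives [d ^ s <= d ^ t]. Asking only for a measurable superset of the ball lets a strip
    replace it. *)
Lemma mass_distribution_cover n (mu : probability (borelRV R n) R)
    (C s t : R) (F : set 'rV[R]_n) : 0 < C -> 0 <= t -> t < s ->
  (forall x (r : R), 0 <= r -> exists B : set (borelRV R n),
    [/\ measurable B, [set y | Defs.edist x y <= r] `<=` B &
        (mu B <= (C * r `^ s)%:E)%E]) ->
  (diam F <= 1%:E)%E ->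
  exists B : set (borelRV R n),
    [/\ measurable B, F `<=` B & (mu B <= C%:E * diam_pow t F)%E].
Proof.
move=> C0 t0 ts ball F1.
rewrite /diam_pow; have [->|/set0P[x Fx]] := eqVneq F set0.
  by exists set0; rewrite measure0 mule0; split.
have diamF y : F y -> ((Defs.edist x y)%:E <= diam F)%E.
  by move=> Fy; apply: ereal_sup_ubound; exists x => //; exists y.
have edist0 y : 0 <= Defs.edist x y by exact: sqrtr_ge0.
case E : (diam F) F1 diamF => [d| |]//; last first.
  by move=> _ /(_ x Fx).
rewrite lee_fin => d1 diamF.
have d0 : 0 <= d by rewrite (le_trans (edist0 x))// -lee_fin diamF.
have [B [mB FB muB]] := ball x d d0.
exists B; split=> //.
  by move=> y Fy; apply: FB => /=; rewrite -lee_fin diamF.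
apply: (le_trans muB); rewrite poweR_EFin -EFinM lee_fin ler_pM2l//.
(* Here [s > 0] makes the left side 0, whereas the right side is 1 when [t = 0]. *)
have [->|d_neq0] := eqVneq d 0.
  by rewrite powR0 ?powR_ge0// gt_eqF// (le_lt_trans t0).
have dpos : 0 < d by rewrite lt_neqAle eq_sym d_neq0.
by apply: ger_powR; [rewrite dpos|exact: ltW].
Qed.

(** For [t < s], any cover of a set of full measure by sets of diameter at most 1 has [t]-sum at
    least [C^-1], so its [t]-dimensional measure is not 0. *)
Lemma mass_distribution n (mu : probability (borelRV R n) R) (C s : R) :
  0 < C ->
  (forall x (r : R), 0 <= r -> exists B : set (borelRV R n),
    [/\ measurable B, [set y | Defs.edist x y <= r] `<=` B &
        (mu B <= (C * r `^ s)%:E)%E]) ->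
  (s%:E <= measure_hausdorff_dim mu)%E.
Proof.
move=> C0 ball; apply: le_ereal_inf_tmp => _ [X [mX muX] <-].
apply: le_ereal_inf_tmp => _ [t [t0 Ht] <-].
rewrite lee_fin leNgt; apply/negP => ts.
suff : ((C^-1)%:E <= hausdorff_measure t X)%E.
  by rewrite Ht lee_fin leNgt invr_gt0 C0.
apply: (@le_trans _ _ (hausdorff_premeasure t 1 X)); last first.
  by apply: ereal_sup_ubound; exists 1 => //; exact: ltr01.
apply: le_ereal_inf_tmp => _ [F [XF F1] <-].
have /choice[B hB] k :=
  @mass_distribution_cover n mu C s t (F k) C0 t0 ts ball (F1 k).
have pow0 k : (0 <= diam_pow t (F k))%E.
  by rewrite /diam_pow; case: ifP => // _; exact: poweR_ge0.
rewrite -(@lee_pmul2l _ C%:E)// -EFinM divff ?gt_eqF//.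
rewrite -nneseriesZl//.
have -> : 1%:E = mu X.
  by rewrite -(probability_setT mu) -(setUv X) measureU0//; exact: measurableC.
apply: (le_trans (@measure_sigma_subadditive _ _ _ mu X B _ _ _)).
- by move=> k; have [] := hB k.
- exact: mX.
- by move=> x /XF[k _ Fx]; exists k => //; have [_ + _] := hB k; apply.
- by apply: lee_nneseries => // k _; have [] := hB k.
Qed.

End mass_distribution.

(** * The parabola and the lifted measure *)

Section parabola.
Context {R : realType}.

Definition parabola (t : R) : 'rV[R]_2 := \row_(j < 2) t ^+ j.+1.

Lemma parabola0 t : parabola t ord0 ord0 = t.
Proof. by rewrite mxE expr1. Qed.

Lemma parabola1 t : parabola t ord0 ord_max = t ^+ 2.
Proof. by rewrite mxE. Qed.

Lemma dotv_rV2 (x y : 'rV[R]_2) :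
  dotv x y = x ord0 ord0 * y ord0 ord0 + x ord0 ord_max * y ord0 ord_max.
Proof.
rewrite /dotv !big_ord_recr big_ord0 /= add0r.
by congr (x _ _ * y _ _ + x _ _ * y _ _); apply/val_inj.
Qed.

Lemma continuous_parabola : continuous parabola.
Proof.
apply: continuous_mx => i j.
rewrite (_ : (fun x => _) = (fun t : R => t ^+ j.+1)); last first.
  by apply/funext => t; rewrite mxE.
exact: exprn_continuous.
Qed.

Lemma compact_parabola (a b : R) : compact (parabola @` `[a, b]).
Proof.
apply: continuous_compact; last exact: segment_compact.
apply: continuous_subspaceT; exact: continuous_parabola.
Qed.

Lemma measurable_parabola :
  measurable_fun [set: measurableTypeR R] (parabola : _ -> borelRV R 2).
Proof.
apply: (@measurability _ _ (measurableTypeR R) (borelRV R 2) setT parabola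
  (@open 'rV[R]_2)) => //.
move=> _ [U Uo <-]; rewrite setTI; apply: open_measurable.
by move/continuousP : continuous_parabola; apply.
Qed.

Definition parabola_spread (w : measurableTypeR R) : borelRV R 2 :=
  parabola (spread_map w).

Lemma measurable_parabola_spread : measurable_fun setT parabola_spread.
Proof.
apply: (measurableT_comp measurable_parabola); exact: measurable_spread_map.
Qed.

HB.instance Definition _ :=
  isMeasurableFun.Build _ _ _ _ parabola_spread measurable_parabola_spread.

Definition parabola_measure : probability (borelRV R 2) R :=
  distribution unif01 parabola_spread.

End parabola.

(** * Dimension, support and injectivity sets of the lifted measure *)

Section parabola_measure.
Context {R : realType}.
Local Notation mu := (@parabola_measure R).

Lemma parabola_measureE (A : set (borelRV R 2)) :
  mu A = unif01 [set w | A (parabola (spread_map w))].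
Proof. by []. Qed.

Lemma parabola_measure_strip (p r : R) : 0 <= r ->
  (mu [set x : 'rV[R]_2 | `|x ord0 ord0 - p| <= r]%R <= (6 * r `^ 2^-1)%:E)%E.
Proof.
move=> r0; rewrite parabola_measureE.
rewrite (_ : [set w | _] = [set w | `|spread_map w - p| <= r]).
  exact: unif01_spread_strip.
by apply/funext => w /=; rewrite parabola0.
Qed.

Lemma measurable_coord_preimage n (i : 'I_n) (A : set (measurableTypeR R)) :
  measurable A ->
  measurable ([set x : 'rV[R]_n | A (x ord0 i)] : set (borelRV R n)).
Proof.
move=> mA; rewrite -[X in measurable X]setTI.
exact: (continuous_measurable_borelRV (@coord_continuous _ 1 n ord0 i)).
Qed.

Lemma measurable_strip n (i : 'I_n) (p r : R) :
  measurable ([set x | `|x ord0 i - p| <= r] : set (borelRV R n)).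
Proof.
apply: (@measurable_coord_preimage n i [set t | `|t - p| <= r]).
rewrite (_ : [set t | _] = `[p - r, p + r]%classic); first exact: measurable_itv.
by apply/funext => t /=; rewrite in_itv /= ler_distl.
Qed.

(** A Euclidean ball lies in the vertical strip over its first coordinates, whose mass is already
    controlled. *)
Lemma parabola_measure_dim : (2^-1%:E <= measure_hausdorff_dim mu)%E.
Proof.
apply: (@mass_distribution _ _ _ 6) => // x r r0.
exists [set y : 'rV[R]_2 | `|y ord0 ord0 - x ord0 ord0| <= r]; split.
- exact: measurable_strip.
- move=> y /=; apply: le_trans.
  by rewrite distrC ler_edist_coord.
- exact: parabola_measure_strip.
Qed.

Lemma spread_map_bound (w : R) : 0 <= w < 1 -> 0 <= spread_map w <= spread_gap.
Proof.
move=> w01; have := spread_map_itv 0 w; rewrite /triadic !mul1r.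
rewrite (@truncn_def _ w 0)//.
by rewrite add0r.
Qed.

(** The arc is compact, so its complement is open; it is null because parameters in [[0, 1)] land on
    the arc. *)
Lemma measure_support_parabola :
  measure_support mu `<=` parabola @` `[0, spread_gap].
Proof.
move=> x suppx; apply: contrapT => nx.
pose K : set 'rV[R]_2 := parabola @` `[0, spread_gap].
have Ko : open (~` K).
  apply: closed_openC; apply: compact_closed; first exact: norm_hausdorff.
  exact: compact_parabola.
have : (0 < mu (~` K))%E by exact: suppx.
rewrite parabola_measureE ltNge => /negP; apply.
rewrite -(@unif01_outside R); apply: le_measure; rewrite ?inE.
- rewrite -[X in measurable X]setTI.
  exact: (measurable_parabola_spread measurableT (open_borelRV Ko)).
- by apply: measurableC; exact: measurable_itv.
- move=> w /= nw; rewrite in_itv /= => w01; apply: nw.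
  by exists (spread_map w) => //=; rewrite in_itv /= spread_map_bound.
Qed.

Lemma compact_measure_support : compact (measure_support mu).
Proof.
apply: subclosed_compact (@measure_support_parabola).
  exact: closed_measure_support.
exact: compact_parabola.
Qed.

(** The triadic interval of level [n] around [w] has positive mass, and its image stays within
    [spread_gap / 9 ^+ n] of [spread_map w]. *)
Lemma measure_support_spread (w : R) : 0 <= w < 1 ->
  measure_support mu (parabola (spread_map w)).
Proof.
move=> /andP[w0 w1] U Uo Uw; rewrite parabola_measureE.
have mU : measurable [set v : measurableTypeR R | U (parabola (spread_map v))].
  rewrite -[X in measurable X]setTI.
  exact: (measurable_parabola_spread measurableT (open_borelRV Uo)).
have : nbhs (spread_map w) (parabola @^-1` U).
  by apply: continuous_parabola; apply: open_nbhs_nbhs.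
move=> /nbhs_ballP[e /= e0 eU].
have [n ne] : exists n, spread_gap < 9 ^+ n * e.
  exists (Num.truncn (spread_gap / e)).+1.
  rewrite -ltr_pdivrMr//; apply: (lt_le_trans (truncnS_gt _)).
  by rewrite -[leRHS]natrX ler_nat ltnW// ltn_expl.
have wn3 : (triadic n w < 3 ^ n)%N.
  rewrite /triadic truncn_lt_nat ?mulr_ge0 ?exprn_ge0//.
  by rewrite natrX -[ltRHS]mulr1 ltr_pM2l// exprn_gt0.
apply: (@lt_le_trans _ _ (unif01 (triadic_itv n (triadic n w)))).
  by rewrite unif01_triadic_itv// lte_fin invr_gt0 exprn_gt0.
apply: le_measure; rewrite ?inE//; first exact: measurable_triadic_itv.
move=> v nv.
have v0 : 0 <= v.
  move: nv; rewrite /triadic_itv /= in_itv /= => /andP[+ _]; apply: le_trans.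
  by rewrite divr_ge0// exprn_ge0.
have vw : triadic n v = triadic n w by apply/triadic_itvP.
apply: eU; rewrite /ball /= -(@ltr_pM2l _ (9 ^+ n)) ?exprn_gt0//.
apply: le_lt_trans ne.
have /andP[v1 v2] := spread_map_itv n v; have /andP[u1 u2] := spread_map_itv n w.
rewrite vw in v1 v2.
rewrite -[X in X * _]ger0_norm ?exprn_ge0// -normrM mulrBr ler_norml.
by apply/andP; split; lra.
Qed.

(** The parameters 0 and 1 / 3 have images with first base-9 digits 0 and 1, which differ since
    [spread_gap < 1]. *)
Lemma measure_support_not_singleton (x : 'rV[R]_2) :
  measure_support mu <> [set x].
Proof.
move=> E.
have h0 : 0 <= (0 : R) < 1 by rewrite lexx ltr01.
have h1 : 0 <= (3^-1 : R) < 1 by apply/andP; split; lra.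
have := measure_support_spread h0; have := measure_support_spread h1.
rewrite E /= => <- /(congr1 (fun y : 'rV[R]_2 => y ord0 ord0)).
rewrite !parabola0 => e.
have /andP[_] := spread_map_itv 1 (0 : R).
have /andP[+ _] := spread_map_itv 1 (3^-1 : R).
rewrite e /triadic !expr1 mulr0 mulfV// truncn0 truncn1/=.
rewrite /spread_gap /sidon_digit /=.
lra.
Qed.

(** Two of its points with parameters [s], [t] cannot span a chord of slope [c]: then [c - s = t]
    would lie in [spread_set]. *)
Definition injectivity_set (c : R) : set (borelRV R 2) :=
  [set x : 'rV[R]_2 | x = parabola (x ord0 ord0) /\ spread_set (x ord0 ord0)] `\`
  [set x : 'rV[R]_2 | spread_set (c - x ord0 ord0)].

Lemma measurable_parabola_graph :
  measurable
    ([set x : 'rV[R]_2 | x = parabola (x ord0 ord0)] : set (borelRV R 2)).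
Proof.
have ch : continuous (fun x : 'rV[R]_2 => x ord0 ord_max - x ord0 ord0 ^+ 2).
  move=> x; apply: (@continuousB _ _ _ (fun x : 'rV[R]_2 => x ord0 ord_max)
    (fun x : 'rV[R]_2 => x ord0 ord0 ^+ 2)); first exact: coord_continuous.
  apply: (@continuous_comp _ _ _ (fun x : 'rV[R]_2 => x ord0 ord0)
    (@GRing.exp R ^~ 2)).
    exact: coord_continuous.
  exact: exprn_continuous.
have := continuous_measurable_borelRV ch measurableT (measurable_set1 0).
rewrite setTI; congr (measurable _).
apply/seteqP; split => x /= xE; last by rewrite xE parabola0 parabola1 subrr.
apply/rowP => i; have [->|->] : i = ord0 \/ i = ord_max.
  by case: i => -[|[|]]// k; [left|right]; exact: val_inj.
- by rewrite parabola0.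
- by rewrite parabola1; apply/eqP; rewrite -subr_eq0 xE.
Qed.

Lemma measurable_injectivity_set c : measurable (injectivity_set c).
Proof.
apply: measurableD.
  apply: measurableI; first exact: measurable_parabola_graph.
  exact: (measurable_coord_preimage ord0 measurable_spread_set).
apply: (@measurable_coord_preimage 2 ord0 [set t | spread_set (c - t)]).
have mf : measurable_fun [set: measurableTypeR R] (fun t => c - t).
  exact: measurable_funB.
rewrite -[X in measurable X]setTI.
by apply: mf => //; exact: measurable_spread_set.
Qed.

(** Lifted points satisfy the first two conditions automatically, so only the reflected set is
    lost. *)
Lemma parabola_measure_injectivity_set c : mu (~` injectivity_set c) = 0%E.
Proof.
rewrite parabola_measureE -(unif01_spread_reflect c); congr unif01.
apply/seteqP; split=> w /=; rewrite /injectivity_set /= parabola0.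
  move=> h; apply: contrapT => nh; apply: h; split=> //; split=> //.
  exact: spread_set_map.
by move=> h [_].
Qed.

(* When v is horizontal the quotient is the junk value 0, which is harmless: the
   first coordinate then already determines a point of the parabola. *)
Lemma injectivity_setP (v : 'rV[R]_2) : v != 0 ->
  {in injectivity_set (- (v ord0 ord0 / v ord0 ord_max)) &,
    forall x y, dotv x v = dotv y v -> x = y}.
Proof.
move=> v0 x y; rewrite !inE => -[[xE xs] xc] [[yE ys] yc].
rewrite !dotv_rV2 xE yE !parabola0 !parabola1.
move: xs xc ys yc => /=.
set s := x ord0 ord0; set t := y ord0 ord0.
set p := v ord0 ord0; set q := v ord0 ord_max => xs xc ys yc e.
suff -> : s = t by [].
(* The difference of the inner products factors through the chord slope [s + t]. *)
have {}e : (s - t) * (p + (s + t) * q) = 0.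
  rewrite (_ : _ * _ = (s * p + s ^+ 2 * q) - (t * p + t ^+ 2 * q)); last by ring.
  by rewrite e subrr.
have [q0|q_neq0] := eqVneq q 0.
  have p_neq0 : p != 0.
    apply: contraNneq v0 => p0; apply/eqP/dotv_eq0.
    by rewrite dotv_rV2 -/p -/q p0 q0 mul0r addr0.
  move/eqP: e; rewrite q0 mulr0 addr0 mulf_eq0 (negPf p_neq0) orbF subr_eq0.
  by move=> /eqP.
move/eqP: e; rewrite mulf_eq0 subr_eq0 => /predU1P[//|/eqP e].
case: xc; rewrite (_ : _ - s = t)//.
apply: (mulIf q_neq0); rewrite mulrBl mulNr divfK//.
by move: e; rewrite mulrDl; lra.
Qed.

End parabola_measure.

Theorem theorem1p9 (R : realType) :
  exists mu : probability (borelRV R 2) R,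
    [/\ compact (measure_support mu),
        (0 < measure_hausdorff_dim mu)%E,
        (forall x : 'rV[R]_2, measure_support mu <> [set x]) &
        forall V : {vspace 'rV[R]_2}, \dim V = 1%N ->
          exists X : set (borelRV R 2),
            [/\ measurable X, mu (~` X) = 0%E & set_inj X (orthproj V)]].
Proof.
exists parabola_measure; split.
- exact: compact_measure_support.
- by apply: lt_le_trans parabola_measure_dim; rewrite lte_fin invr_gt0.
- exact: measure_support_not_singleton.
move=> V dimV; pose v := vpick V.
have v0 : v != 0.
  by rewrite vpick0; apply: contra_eq_neq dimV => ->; rewrite dimv0.
(* Equal projections thus give equal inner products with [v]. *)
have dotproj x : dotv x v = dotv (orthproj V x) v.
  have [_ /(_ v (memv_pick V))] := orthprojP V x.
  have -> : x - orthproj V x = -1 *: orthproj V x + x.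
    by rewrite scaleN1r addrC.
  by rewrite dotvDl mulN1r => /eqP; rewrite addrC subr_eq0 => /eqP.
(* The constant is the slope of the lines orthogonal to [v], when these are not vertical. *)
exists (injectivity_set (- (v ord0 ord0 / v ord0 ord_max))); split.
- exact: measurable_injectivity_set.
- exact: parabola_measure_injectivity_set.
- move=> x y xX yX xy; apply: (injectivity_setP v0) => //.
  by rewrite dotproj xy -dotproj.
Qed.
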